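(* Let $Q_t(z)\in\mathbb{C}[[z,t]]$ with $o(Q_t(z))\ge 2$ and let $P(z)\in\mathbb{C}[[z]]$ be Hessian nilpotent with $o(P(z))\ge 2$. The following statements are equivalent. (1) $Q_t(z)$ is the deformed inversion pair of $P(z)$. (2) $Q_t(z)$ is the unique power series solution of the Cauchy problem $$\frac{\partial Q_t(z)}{\partial t}=\frac14\,\Delta Q_t^2(z),\qquad Q_{t=0}(z)=P(z).$$ Furthermore, writing the deformed inversion pair as $Q_t(z)=\sum_{m=1}^\infty t^{m-1}Q_{[m]}(z)$ with $Q_{[m]}(z)\in\mathbb{C}[[z]]$, one has $Q_{[1]}(z)=P(z)$ and, for every $m\ge 2$, $$Q_{[m]}(z)=\frac{1}{4(m-1)}\,\Delta\sum_{\substack{k,l\ge 1\\ k+l=m}}Q_{[k]}(z)\,Q_{[l]}(z).$$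
   Context: Here $z=(z_1,\dots,z_n)$, $t$ is a formal parameter commuting with $z$, $\Delta=\sum_{i=1}^n \partial^2/\partial z_i^2$, and $o(\cdot)$ denotes the order with respect to $z$ (lowest degree in $z$ of a monomial occurring). $P$ is Hessian nilpotent if its Hessian matrix $\left(\frac{\partial^2 P}{\partial z_i\partial z_j}\right)$ is nilpotent. For $P\in\mathbb{C}[[z]]$ with $o(P)\ge 2$, the deformed inversion pair of $P$ is the unique $Q_t(z)\in\mathbb{C}[[z,t]]$ with $o(Q_t(z))\ge 2$ such that $z+t\nabla Q_t(z)$ is the formal (compositional, in $z$) inverse of $z-t\nabla P(z)$, where $\nabla$ is the gradient in $z$. *)

(* Defs.v *)
From HB Require Import structures.
From mathcomp Require Import all_boot all_order all_algebra.
From mathcomp Require Import boolp reals complex.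
From mathcomp Require Import mpoly.

Set Implicit Arguments.
Unset Strict Implicit.
Unset Printing Implicit Defensive.

Import GRing.Theory.
Local Open Scope ring_scope.

(* Formal power series in n commuting variables over R: arbitrary families of
   coefficients indexed by the multi-indices 'X_{1..n} of mpoly. *)
Record mpseries (n : nat) (R : Type) : Type :=
  MPSeries { psfun :> 'X_{1..n} -> R }.

HB.instance Definition _ n R := gen_eqMixin (mpseries n R).
HB.instance Definition _ n R := gen_choiceMixin (mpseries n R).

Lemma mpseriesP n R (f g : mpseries n R) : (forall m, f m = g m) -> f = g.
Proof. by case: f g => [f] [g] /= fg; congr MPSeries; apply/funext. Qed.

Section Ring.
Variables (n : nat) (R : comNzRingType).
Implicit Types (f g h : mpseries n R) (p q : {mpoly R[n]}) (m : 'X_{1..n}).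

Definition ps_zero : mpseries n R := MPSeries (fun=> 0).
Definition ps_opp f : mpseries n R := MPSeries (fun m => - f m).
Definition ps_add f g : mpseries n R := MPSeries (fun m => f m + g m).

Definition psC (c : R) : mpseries n R := MPSeries (fun m => c *+ (m == 0%MM)).
Definition psX (i : 'I_n) : mpseries n R :=
  MPSeries (fun m => (m == U_(i)%MM)%:R).

(* The Cauchy product; the bound on the degrees only makes the index type
   finite, cf. mcoeffM. *)
Definition ps_mul f g : mpseries n R := MPSeries (fun m =>
  \sum_(k : 'X_{1..n < (mdeg m).+1, (mdeg m).+1} | m == (k.1 + k.2)%MM)
     f k.1 * g k.2).

Fact ps_addA : associative ps_add.
Proof. by move=> f g h; apply/mpseriesP => m /=; rewrite addrA. Qed.
Fact ps_addC : commutative ps_add.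
Proof. by move=> f g; apply/mpseriesP => m /=; rewrite addrC. Qed.
Fact ps_add0 : left_id ps_zero ps_add.
Proof. by move=> f; apply/mpseriesP => m /=; rewrite add0r. Qed.
Fact ps_addN : left_inverse ps_zero ps_opp ps_add.
Proof. by move=> f; apply/mpseriesP => m /=; rewrite addNr. Qed.

HB.instance Definition _ :=
  GRing.isZmodule.Build (mpseries n R) ps_addA ps_addC ps_add0 ps_addN.

(* The ring axioms are transferred from {mpoly R[n]} by truncation. *)
Definition ps_trunc d f : {mpoly R[n]} :=
  \sum_(k : 'X_{1..n < d}) f k *: 'X_[k].

Lemma ps_truncE d f m : (mdeg m < d)%N -> (ps_trunc d f)@_m = f m.
Proof.
move=> md; rewrite /ps_trunc linear_sum /= (bigD1 (BMultinom md)) //=.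
rewrite mcoeffZ mcoeffX eqxx mulr1 big1 ?addr0 // => k.
rewrite mcoeffZ mcoeffX -val_eqE /= => /negbTE ->; exact: mulr0.
Qed.

Lemma ps_mulE f g p q m :
    (forall k, (mdeg k <= mdeg m)%N -> p@_k = f k) ->
    (forall k, (mdeg k <= mdeg m)%N -> q@_k = g k) ->
  (ps_mul f g) m = (p * q)@_m.
Proof.
move=> pf qg; rewrite mcoeffM /=; apply: eq_bigr => k _.
by rewrite pf ?qg // -ltnS bmdeg.
Qed.

Lemma ps_mul_trunc d f g m : (mdeg m < d)%N ->
  (ps_mul f g) m = (ps_trunc d f * ps_trunc d g)@_m.
Proof.
by move=> md; apply: ps_mulE => k km; rewrite ps_truncE // (leq_ltn_trans km).
Qed.

Fact ps_mulA : associative ps_mul.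
Proof.
move=> f g h; apply/mpseriesP => m; pose T := ps_trunc (mdeg m).+1.
rewrite (@ps_mulE _ _ (T f) (T g * T h)) ?mulrA.
- symmetry; apply: ps_mulE => k km; last by rewrite ps_truncE.
  by rewrite -ps_mul_trunc.
- by move=> k km; rewrite ps_truncE.
- by move=> k km; rewrite -ps_mul_trunc.
Qed.

Fact ps_mulC : commutative ps_mul.
Proof.
move=> f g; apply/mpseriesP => m.
by rewrite !(@ps_mul_trunc (mdeg m).+1) // mulrC.
Qed.

Fact ps_mul1 : left_id (psC 1) ps_mul.
Proof.
move=> f; apply/mpseriesP => m.
rewrite (@ps_mulE _ _ 1 (ps_trunc (mdeg m).+1 f)) ?mul1r ?ps_truncE // => k km.
  by rewrite mcoeff1 /=.
by rewrite ps_truncE.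
Qed.

Fact ps_mulD : left_distributive ps_mul ps_add.
Proof.
move=> f g h; apply/mpseriesP => m; pose T := ps_trunc (mdeg m).+1.
rewrite (@ps_mulE _ _ (T f + T g) (T h)) ?mulrDl ?mcoeffD.
- by rewrite /= -!(@ps_mul_trunc (mdeg m).+1).
- by move=> k km; rewrite mcoeffD !ps_truncE.
- by move=> k km; rewrite ps_truncE.
Qed.

Fact ps_1neq0 : psC 1 != 0 :> mpseries n R.
Proof.
apply/eqP => /(congr1 (fun f : mpseries n R => f 0%MM)) /= /eqP.
by rewrite eqxx oner_eq0.
Qed.

HB.instance Definition _ := GRing.Zmodule_isComNzRing.Build (mpseries n R)
  ps_mulA ps_mulC ps_mul1 ps_mulD ps_1neq0.

Definition ps_scale (c : R) f : mpseries n R := MPSeries (fun m => c * f m).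

Fact ps_scaleA a b f : ps_scale a (ps_scale b f) = ps_scale (a * b) f.
Proof. by apply/mpseriesP => m /=; rewrite mulrA. Qed.
Fact ps_scale1 : left_id 1 ps_scale.
Proof. by move=> f; apply/mpseriesP => m /=; rewrite mul1r. Qed.
Fact ps_scaleDr : right_distributive ps_scale +%R.
Proof. by move=> a f g; apply/mpseriesP => m /=; rewrite mulrDr. Qed.
Fact ps_scaleDl f : {morph ps_scale^~ f : a b / a + b}.
Proof. by move=> a b; apply/mpseriesP => m /=; rewrite mulrDl. Qed.

HB.instance Definition _ := GRing.Zmodule_isLmodule.Build R (mpseries n R)
  ps_scaleA ps_scale1 ps_scaleDr ps_scaleDl.

Fact ps_scaleAl (a : R) (f g : mpseries n R) : a *: (f * g) = (a *: f) * g.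
Proof.
apply/mpseriesP => m /=; rewrite mulr_sumr.
by apply: eq_bigr => k _; rewrite mulrA.
Qed.

HB.instance Definition _ :=
  GRing.Lmodule_isLalgebra.Build R (mpseries n R) ps_scaleAl.
HB.instance Definition _ :=
  GRing.Lalgebra_isComAlgebra.Build R (mpseries n R).

(* o(f) >= d; in particular o(0) is infinite. *)
Definition ps_order_ge (d : nat) f : Prop :=
  forall m, f m != 0 -> (d <= mdeg m)%N.

Definition ps_deriv (i : 'I_n) f : mpseries n R :=
  MPSeries (fun m => f (m + U_(i))%MM *+ (m i).+1).

Definition laplacian f : mpseries n R := \sum_(i < n) ps_deriv i (ps_deriv i f).

Definition hessian f : 'M[mpseries n R]_n :=
  \matrix_(i < n, j < n) ps_deriv i (ps_deriv j f).

Definition hessian_nilpotent f : Prop := exists k : nat, hessian f ^+ k = 0.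

(* The substitution f(g_0, ..., g_(n-1)), for g_i without constant term: then
   g^k has order at least |k|, so that only the k with |k| <= |m| contribute to
   the coefficient of index m.  It is a junk value for other g. *)
Definition ps_comp f (g : 'I_n -> mpseries n R) : mpseries n R :=
  MPSeries (fun m => \sum_(k : 'X_{1..n < (mdeg m).+1})
                        f k * (\prod_(i < n) g i ^+ k i) m).

Definition formal_inverse (F G : 'I_n -> mpseries n R) : Prop :=
  (forall i, ps_comp (F i) G = psX i) /\ (forall i, ps_comp (G i) F = psX i).

End Ring.

Arguments psC {n R} c.
Arguments psX {n R} i.

(* C[[z,t]] is represented as C[[t]][[z]]: orders, derivatives with respect to
   z and composition in z are then the above notions over the coefficient ring
   C[[t]]. *)
Notation ztseries n C := (mpseries n (mpseries 1 C)).

Section Deformation.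
Variables (n : nat) (C : comNzRingType).
Implicit Types (P : mpseries n C) (Q : ztseries n C).

Definition tvar : mpseries 1 C := psX ord0.

Definition zt_const P : ztseries n C := MPSeries (fun m => psC (P m)).

(* The coefficient in C[[z]] of t^k. *)
Definition tcoef (k : nat) Q : mpseries n C :=
  MPSeries (fun m => Q m (U_(ord0) *+ k)%MM).

Definition tderiv Q : ztseries n C := MPSeries (fun m => ps_deriv ord0 (Q m)).

Definition inversion_pair P Q : Prop :=
  ps_order_ge 2 Q /\
  formal_inverse (fun i => psX i - tvar *: ps_deriv i (zt_const P))
                 (fun i => psX i + tvar *: ps_deriv i Q).

Definition deformed_inversion_pair P Q : Prop := unique (inversion_pair P) Q.

End Deformation.

Section Cauchy.
Variables (n : nat) (C : fieldType).

Definition cauchy_solution (P : mpseries n C) (Q : ztseries n C) : Prop :=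
  tderiv Q = psC (4%:R^-1) *: laplacian (Q ^+ 2) /\ tcoef 0 Q = P.

End Cauchy.

(* Main.v *)
(** Let [Q] be the solution of the Hamilton-Jacobi equation
    [dQ/dt = 1/2 sum_j (d_j Q)^2] with [Q = P] at [t = 0], and let [u] be its
    gradient.  Then [u] solves the Burgers equation [D u_i = 0] for the
    derivation [D = d/dt - sum_j u_j d_j], which also kills [G := z + t u], hence
    every [f(G)] with [f] independent of [t].  As an element killed by [D] is
    determined by its value at [t = 0], [u_i = (d_i P)(G)]; that is, [G] is a
    right inverse of [z - t grad P].  It is a left inverse too, because
    substituting [G] is injective.

    Differentiating the Burgers equation gives [D H = H^2] for the Hessian [H] of
    [Q], so [D tr(H^k) = k tr(H^(k+1))].  If the Hessian of [P] is nilpotent, all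
    these traces vanish at [t = 0], hence identically; in particular
    [Delta Q = tr H = 0] and [1/4 Delta(Q^2) = 1/2 sum_j (d_j Q)^2].  So [Q] is
    both the inversion pair and the solution of the Cauchy problem, each of which
    is unique. *)

From HB Require Import structures.
Require Import Defs.
From mathcomp Require Import all_boot all_order all_algebra.
From mathcomp Require Import boolp reals complex.
From mathcomp Require Import mpoly.

Set Implicit Arguments.
Unset Strict Implicit.
Unset Printing Implicit Defensive.

Import GRing.Theory.
Local Open Scope ring_scope.

(** * Formal power series *)

Section PowerSeries.
Variables (n : nat) (R : comNzRingType).
Implicit Types (f g h : mpseries n R) (p q : {mpoly R[n]}) (m k : 'X_{1..n}).

Lemma psD f g m : (f + g) m = f m + g m. Proof. by []. Qed.
Lemma psB f g m : (f - g) m = f m - g m. Proof. by []. Qed.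
Lemma ps0 m : (0 : mpseries n R) m = 0. Proof. by []. Qed.
Lemma psZ c f m : (c *: f) m = c * f m. Proof. by []. Qed.
Lemma ps1 m : (1 : mpseries n R) m = (m == 0%MM)%:R. Proof. by []. Qed.
Lemma psM f g : f * g = ps_mul f g. Proof. by []. Qed.

Lemma ps_sumE (I : Type) (r : seq I) (P : pred I) (F : I -> mpseries n R) m :
  (\sum_(i <- r | P i) F i) m = \sum_(i <- r | P i) F i m.
Proof. exact: (big_morph (fun f => f m)). Qed.

Lemma psMn f m j : (f *+ j) m = f m *+ j.
Proof. by elim: j => // j IH; rewrite !mulrS psD IH. Qed.

Lemma psC_mul c f : psC c * f = c *: f.
Proof.
rewrite -[in RHS](mul1r f) scalerAl; congr (_ * _); apply/mpseriesP => m.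
by rewrite psZ ps1 /= mulr_natr.
Qed.

Lemma ps_mul_congr f f' g g' m :
    (forall k, (mdeg k <= mdeg m)%N -> f k = f' k) ->
    (forall k, (mdeg k <= mdeg m)%N -> g k = g' k) ->
  (f * g) m = (f' * g') m.
Proof.
by move=> ff' gg'; apply: eq_bigr => k _; rewrite ff' ?gg' // -ltnS bmdeg.
Qed.

Definition ps_of_mpoly p : mpseries n R := MPSeries (fun m => p@_m).

Lemma ps_of_mpolyM p q : ps_of_mpoly (p * q) = ps_of_mpoly p * ps_of_mpoly q.
Proof. by apply/mpseriesP => m; rewrite psM (@ps_mulE _ _ _ _ p q). Qed.

Lemma ps_of_mpoly1 : ps_of_mpoly 1 = 1.
Proof. by apply/mpseriesP => m; rewrite /= mcoeff1. Qed.

(** Computed among polynomials, where the power product of the variables is the monomial ['X_[k]];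
    the embedding [ps_of_mpoly] is multiplicative. *)
Lemma mmap1_psX k m : mmap1 psX k m = (k == m)%:R :> R.
Proof.
transitivity ((ps_of_mpoly 'X_[k]) m); last by rewrite /= mcoeffX.
rewrite mpolyXE_id (big_morph _ ps_of_mpolyM ps_of_mpoly1).
congr (psfun _ m); apply: eq_bigr => i _.
elim: (k i) => [|e IH]; first by rewrite !expr0 ps_of_mpoly1.
rewrite !exprS ps_of_mpolyM IH; congr (_ * _).
by apply/mpseriesP => m'; rewrite /= mcoeffX eq_sym.
Qed.

(** * Partial derivatives *)

Fact ps_deriv_is_linear i : linear (@ps_deriv n R i).
Proof. by move=> c f g; apply/mpseriesP => m; rewrite /= mulrnDl mulrnAr. Qed.

HB.instance Definition _ i :=
  GRing.isLinear.Build R _ _ _ (@ps_deriv n R i) (ps_deriv_is_linear i).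

Lemma ps_derivM i f g :
  ps_deriv i (f * g) = ps_deriv i f * g + f * ps_deriv i g.
Proof.
(* The Leibniz rule is inherited from polynomials. The truncation keeps one degree more than
   [mdeg m], because a derivative at [m] reads the coefficient at [m + U_(i)]. *)
apply/mpseriesP => m; pose T u : {mpoly R[n]} := ps_trunc (mdeg m).+2 u.
have TE k u : (mdeg k <= (mdeg m).+1)%N -> (T u)@_k = u k.
  by move=> km; rewrite ps_truncE.
have TD k u : (mdeg k <= mdeg m)%N -> ((T u)^`M(i))@_k = ps_deriv i u k.
  by move=> km; rewrite mcoeff_mderiv TE // mdegD mdeg1 addn1.
rewrite psD !psM (@ps_mulE _ _ (ps_deriv i f) g (T f)^`M(i) (T g));
  [|by move=> k /TD|by move=> k /leqW /TE].
rewrite (@ps_mulE _ _ f (ps_deriv i g) (T f) (T g)^`M(i));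
  [|by move=> k /leqW /TE|by move=> k /TD].
rewrite -mcoeffD -mderivM mcoeff_mderiv; congr (_ *+ _).
by apply: ps_mulE => k; rewrite mdegD mdeg1 addn1; apply: TE.
Qed.

Lemma ps_derivC i j f : ps_deriv i (ps_deriv j f) = ps_deriv j (ps_deriv i f).
Proof.
apply/mpseriesP => m /=; rewrite -!mulrnA !mnmDE !mnm1E -!addmA.
rewrite [(U_(j) + _)%MM]addmC (eq_sym j).
by case: eqVneq => [->//|_]; rewrite !addn0 mulnC.
Qed.

Lemma ps_derivX i j : ps_deriv i (psX j) = (i == j)%:R :> mpseries n R.
Proof.
apply/mpseriesP => m; rewrite psMn ps1 /=.
have [<-|neq_ij] := eqVneq i j.
  rewrite -[X in _ == X](add0m U_(i)%MM) (inj_eq (@addIm _ _)).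
  by case: eqVneq => [->|_]; rewrite ?mnm0E ?mul0rn.
rewrite (_ : (_ == _) = false) ?mul0rn //; apply/negP => /eqP/mnmP/(_ i).
by rewrite mnmDE !mnm1E eqxx eq_sym (negbTE neq_ij) addn1.
Qed.

(** * Order *)

Lemma ps_order_geP d f :
  ps_order_ge d f <-> forall m, (mdeg m < d)%N -> f m = 0.
Proof.
split=> [df m md|df m]; last by rewrite leqNgt; apply: contraNN => /df ->.
by apply/eqP; apply: contraLR md => /df; rewrite -leqNgt.
Qed.

Lemma ps_order_ge0 f : ps_order_ge 0 f. Proof. by []. Qed.

Lemma ps_order_ge_zero d : ps_order_ge d (0 : mpseries n R).
Proof. by move=> m; rewrite ps0 eqxx. Qed.

Lemma ps_order_geD d f g :
  ps_order_ge d f -> ps_order_ge d g -> ps_order_ge d (f + g).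
Proof.
by move=> /ps_order_geP df /ps_order_geP dg; apply/ps_order_geP => m md;
  rewrite psD df ?dg ?addr0.
Qed.

Lemma ps_order_ge_sum d (I : Type) (r : seq I) (P : pred I) F :
    (forall i, P i -> ps_order_ge d (F i : mpseries n R)) ->
  ps_order_ge d (\sum_(i <- r | P i) F i).
Proof.
by move=> dF; apply: big_ind => //;
  [exact: ps_order_ge_zero | exact: ps_order_geD].
Qed.

Lemma ps_order_geZ d c f : ps_order_ge d f -> ps_order_ge d (c *: f).
Proof.
by move=> /ps_order_geP df; apply/ps_order_geP => m md; rewrite psZ df ?mulr0.
Qed.

Lemma ps_order_geB d f g :
  ps_order_ge d f -> ps_order_ge d g -> ps_order_ge d (f - g).
Proof.
by move=> df dg; rewrite -scaleN1r; apply/ps_order_geD/ps_order_geZ.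
Qed.

Lemma ps_order_geM d e f g :
  ps_order_ge d f -> ps_order_ge e g -> ps_order_ge (d + e) (f * g).
Proof.
move=> /ps_order_geP df /ps_order_geP eg; apply/ps_order_geP => m md.
rewrite psM /= big1 // => k /eqP mk.
have [/df ->|dk1] := ltnP (mdeg k.1) d; first by rewrite mul0r.
rewrite (eg k.2) ?mulr0 // -(ltn_add2l d); apply: leq_ltn_trans md.
by apply: (@leq_trans (mdeg (k.1 + k.2)%MM));
  [rewrite mdegD leq_add2r | rewrite -mk].
Qed.

Lemma ps_order_ge_leq d e f :
  (e <= d)%N -> ps_order_ge d f -> ps_order_ge e f.
Proof. by move=> ed df m /df; apply: leq_trans. Qed.

Lemma ps_order_ge_deriv d i f :
  ps_order_ge d.+1 f -> ps_order_ge d (ps_deriv i f).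
Proof.
move=> /ps_order_geP df; apply/ps_order_geP => m md.
by rewrite /= df ?mul0rn // mdegD mdeg1 addn1.
Qed.

Lemma ps_order_geX i : ps_order_ge 1 (psX i : mpseries n R).
Proof.
apply/ps_order_geP => m; rewrite ltnS leqn0 mdeg_eq0 => /eqP -> /=.
by case: eqP => // /mnmP/(_ i); rewrite mnm0E mnm1E eqxx.
Qed.

Lemma ps_eq0_order f : (forall d, ps_order_ge d f) -> f = 0.
Proof.
move=> df; apply/mpseriesP => m; have /ps_order_geP -> // := df (mdeg m).+1.
Qed.

(** * Composition *)

Lemma ps_comp_congr f f' (g : 'I_n -> mpseries n R) m :
    (forall k, (mdeg k <= mdeg m)%N -> f k = f' k) ->
  ps_comp f g m = ps_comp f' g m.
Proof. by move=> ff'; apply: eq_bigr => k _; rewrite ff' // -ltnS bmdeg. Qed.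

Lemma ps_comp_mmap1 f (g : 'I_n -> mpseries n R) m :
  ps_comp f g m = \sum_(k : 'X_{1..n < (mdeg m).+1}) f k * mmap1 g k m.
Proof. by []. Qed.

Lemma ps_comp_psX f : ps_comp f psX = f.
Proof.
apply/mpseriesP => m; rewrite ps_comp_mmap1.
rewrite (bigD1 (BMultinom (ltnSn (mdeg m)))) //= mmap1_psX eqxx mulr1.
rewrite big1 ?addr0 // => k; rewrite -val_eqE /= => km.
by rewrite mmap1_psX (negbTE km) mulr0.
Qed.

Lemma ps_compX i (g : 'I_n -> mpseries n R) :
  ps_order_ge 1 (g i) -> ps_comp (psX i) g = g i.
Proof.
move=> /ps_order_geP g1; apply/mpseriesP => m; rewrite ps_comp_mmap1 /=.
have [m0|m_gt0] := posnP (mdeg m).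
  rewrite g1 ?m0 // big1 // => k _; rewrite (_ : (_ == _) = false) ?mul0r //.
  apply/negP => /eqP kE; have := bmdeg k.
  by rewrite kE mdeg1.
have U_lt : (mdeg U_(i)%MM < (mdeg m).+1)%N by rewrite mdeg1.
rewrite (bigD1 (BMultinom U_lt)) //= eqxx mul1r mmap1U big1 ?addr0 // => k.
by rewrite -val_eqE /= => /negbTE ->; rewrite mul0r.
Qed.

Lemma ps_compD f f' (g : 'I_n -> mpseries n R) :
  ps_comp (f + f') g = ps_comp f g + ps_comp f' g.
Proof.
apply/mpseriesP => m; rewrite psD /= -big_split /=.
by apply: eq_bigr => k _; rewrite mulrDl.
Qed.

Lemma ps_compZ c f (g : 'I_n -> mpseries n R) :
  ps_comp (c *: f) g = c *: ps_comp f g.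
Proof.
apply/mpseriesP => m; rewrite psZ /= mulr_sumr.
by apply: eq_bigr => k _; rewrite mulrA.
Qed.

Lemma ps_compB f f' (g : 'I_n -> mpseries n R) :
  ps_comp (f - f') g = ps_comp f g - ps_comp f' g.
Proof. by rewrite -scaleN1r ps_compD ps_compZ scaleN1r. Qed.

Section Substitution.
Variable g : 'I_n -> mpseries n R.
Hypothesis g1 : forall i, ps_order_ge 1 (g i).

Lemma ps_order_ge_mmap1 k : ps_order_ge (mdeg k) (mmap1 g k).
Proof.
rewrite mdegE /mmap1; apply: (big_ind2 (fun d => @ps_order_ge n R d)).
- exact: ps_order_ge0.
- by move=> d f e f'; exact: ps_order_geM.
move=> i _; elim: (k i) => [|e IH]; first exact: ps_order_ge0.
by rewrite exprS -add1n; apply: ps_order_geM.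
Qed.

Local Notation subst p := (mmap (@GRing.in_alg R (mpseries n R)) g p).

(** Since no [g i] has a constant term, [g^k] has order at least [|k|], so monomials of degree above
    [|m|] cannot reach the coefficient at [m]. Substitution thus becomes the polynomial morphism
    [mmap] applied to any good enough approximation of [f]. *)
Lemma ps_compE f p m : (forall k, (mdeg k <= mdeg m)%N -> p@_k = f k) ->
  ps_comp f g m = (subst p) m.
Proof.
move=> pf; pose q := ps_trunc (mdeg m).+1 f.
have -> : ps_comp f g m = (subst q) m.
  rewrite /q /ps_trunc raddf_sum ps_sumE ps_comp_mmap1.
  by apply: eq_bigr => k _; rewrite /= mmapZ mmapX mulr_algl psZ.
apply/eqP; rewrite -subr_eq0 -psB -mmapB {1}/mmap ps_sumE; apply/eqP.
rewrite big_seq big1 // => k; rewrite mcoeff_msupp mcoeffB => kqp.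
rewrite mulr_algl psZ; have [km|mk] := leqP (mdeg k) (mdeg m).
  by rewrite ps_truncE // pf // subrr eqxx in kqp.
by have /ps_order_geP -> := ps_order_ge_mmap1 (k := k); rewrite ?mulr0.
Qed.

Lemma ps_compM f f' : ps_comp (f * f') g = ps_comp f g * ps_comp f' g.
Proof.
apply/mpseriesP => m; pose T u : {mpoly R[n]} := ps_trunc (mdeg m).+1 u.
have TE u k : (mdeg k <= mdeg m)%N -> (T u)@_k = u k.
  by move=> km; rewrite ps_truncE.
have cE u k : (mdeg k <= mdeg m)%N -> ps_comp u g k = (subst (T u)) k.
  by move=> km; apply: ps_compE => j jk; rewrite TE // (leq_trans jk).
rewrite (ps_mul_congr (fun k => cE f k) (fun k => cE f' k)) -rmorphM.
apply: ps_compE => k km; rewrite psM; symmetry; apply: ps_mulE => j jk.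
  by rewrite TE // (leq_trans jk).
by rewrite TE // (leq_trans jk).
Qed.

Lemma ps_comp1 : ps_comp 1 g = 1.
Proof.
by apply/mpseriesP => m; rewrite (@ps_compE _ 1) ?rmorph1 // => k _;
  rewrite mcoeff1.
Qed.

Lemma ps_comp_mmap1M (F : 'I_n -> mpseries n R) k :
  ps_comp (mmap1 F k) g = mmap1 (fun i => ps_comp (F i) g) k.
Proof.
rewrite /mmap1 (big_morph (fun f => ps_comp f g) ps_compM ps_comp1).
apply: eq_bigr => i _.
by elim: (k i) => [|e IH]; rewrite ?ps_comp1 // !exprS ps_compM IH.
Qed.

End Substitution.

Lemma ps_comp_sum (I : Type) (r : seq I) (P : pred I) F
    (g : 'I_n -> mpseries n R) :
  ps_comp (\sum_(i <- r | P i) F i) g = \sum_(i <- r | P i) ps_comp (F i) g.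
Proof.
apply: (big_morph (fun f => ps_comp f g)) => [f f'|]; first exact: ps_compD.
by have := ps_compZ 0 0 g; rewrite !scale0r.
Qed.

Lemma ps_compA f (F G : 'I_n -> mpseries n R) :
    (forall i, ps_order_ge 1 (F i)) -> (forall i, ps_order_ge 1 (G i)) ->
  ps_comp (ps_comp f F) G = ps_comp f (fun i => ps_comp (F i) G).
Proof.
move=> F1 G1; apply/mpseriesP => m.
(* At index [m] only the part of [f] of degree at most [|m|] counts; on this finite sum,
   substituting [G] is additive and multiplicative. *)
pose S := \sum_(k : 'X_{1..n < (mdeg m).+1}) f k *: mmap1 F k.
rewrite (@ps_comp_congr _ S) => [|k km]; last first.
  rewrite (@ps_compE _ F1 _ (ps_trunc (mdeg m).+1 f)) => [|j jk]; last first.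
    by rewrite ps_truncE // ltnS (leq_trans jk).
  rewrite raddf_sum /= /S. congr (psfun _ k); apply: eq_bigr => j _.
  by rewrite mmapZ mmapX mulr_algl.
rewrite ps_comp_sum ps_sumE ps_comp_mmap1; apply: eq_bigr => k _.
by rewrite ps_compZ ps_comp_mmap1M.
Qed.

End PowerSeries.

(** * Traces of nilpotent matrices *)

(** The characteristic polynomial divides a power of ['X]; being monic of degree [n], it is ['X^n]
    over a domain, and the trace is minus its subleading coefficient. *)
Lemma mxtrace_nilpotent (R : idomainType) n (A : 'M[R]_n) N :
  A ^+ N = 0 -> \tr A = 0.
Proof.
case: n A => [|n] A AN; first by rewrite /mxtrace big_ord0.
pose B := map_mx polyC A; pose Xn : 'M[{poly R}]_n.+1 := 'X%:M.
(* Take determinants in the factorization of [Xn ^+ N - B ^+ N] by [Xn - B], where [B ^+ N = 0]; a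
   scalar matrix of size [n.+1] accounts for the exponent. *)
have: char_poly A %| ('X - 0%:P) ^+ (N * n.+1)%N.
  have BN : B ^+ N = 0.
    have := rmorphXn (map_mx (@polyC R) : {rmorphism 'M[R]_n.+1 -> _}) N A.
    by rewrite /= AN map_mx0 => <-.
  have XN : Xn ^+ N = ('X ^+ N)%:M.
    elim: N {AN BN} => [|N IH]; first by rewrite !expr0.
    by rewrite !exprS IH -mulmxE -scalar_mxM.
  have cXB : GRing.comm Xn B by rewrite /GRing.comm -!mulmxE scalar_mxC.
  have /(congr1 determinant) := subrXX_comm N cXB.
  rewrite BN subr0 XN det_scalar -exprM -mulmxE det_mulmx polyC0 subr0 => ->.
  rewrite /char_poly /char_poly_mx -/B -/Xn. by rewrite dvdp_mulr.
move=> /dvdp_exp_XsubCP[k _]. rewrite polyC0 subr0.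
rewrite eqp_monic ?char_poly_monic ?monicXn // => /eqP cE.
have := size_char_poly A; rewrite cE size_polyXn => -[kE].
apply: oppr_inj; rewrite oppr0 -char_poly_trace // cE kE coefXn /=.
by rewrite ltn_eqF.
Qed.

(** * Power series over a domain form a domain *)

Section Domain.
Variables (n : nat) (R : idomainType).
Implicit Types (f g : mpseries n R).

(** The trace lemma will be applied over a ring of series, so these need the integral domain
    structure. It includes units and inverses, which are chosen classically, with the identity as
    default inverse of a non-unit. *)
Definition ps_unit : pred (mpseries n R) := fun f => `[< exists g, g * f = 1 >].

Definition ps_inv f : mpseries n R :=
  if pselect (exists g, g * f = 1) is left fU then projT1 (cid fU) else f.

Fact ps_mulVf : {in ps_unit, left_inverse 1 ps_inv *%R}.
Proof.
move=> f /asboolP fU; rewrite /ps_inv; case: pselect => // {}fU.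
by case: cid.
Qed.

Fact ps_unitP f g : g * f = 1 -> ps_unit f.
Proof. by move=> gf; apply/asboolP; exists g. Qed.

Fact ps_inv_out : {in [predC ps_unit], ps_inv =1 id}.
Proof.
by move=> f /asboolPn fU; rewrite /ps_inv; case: pselect.
Qed.

HB.instance Definition _ := GRing.ComNzRing_hasMulInverse.Build (mpseries n R)
  ps_mulVf ps_unitP ps_inv_out.

(** The monomial order is well-founded, so even an infinite support has a least element. *)
Lemma ps_neq0_minimal f : f != 0 ->
  exists2 m, f m != 0 & forall k, (k < m)%O -> f k = 0.
Proof.
move=> f0; have [m fm] : exists m, f m != 0.
  apply: contrapT => fE; case/eqP: f0; apply/mpseriesP => m; apply/eqP.
  by apply: contrapT => fm; apply: fE; exists m; apply/negP.
elim/(well_founded_ind (@ltom_wf n)): m fm => m IH fm.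
have [[k km fk]|no_k] := pselect (exists2 k, (k < m)%O & f k != 0).
  exact: IH fk.
exists m => // k km; apply/eqP; apply: contrapT => /negP fk.
by apply: no_k; exists k.
Qed.

(* The least monomials of the factors, for the degree order, multiply to the
   least monomial of the product. *)
Fact ps_mulf_eq0 f g : f * g = 0 -> (f == 0) || (g == 0).
Proof.
move=> fg0; apply: contrapT => /negP; rewrite negb_or => /andP[].
move=> /ps_neq0_minimal[a fa af] /ps_neq0_minimal[b gb bg].
have /eqP := congr1 (fun h : mpseries n R => h (a + b)%MM) fg0.
have al : (mdeg a < (mdeg (a + b)%MM).+1)%N by rewrite mdegD ltnS leq_addr.
have bl : (mdeg b < (mdeg (a + b)%MM).+1)%N by rewrite mdegD ltnS leq_addl.
rewrite psM /= (bigD1 (BMultinom al, BMultinom bl)) //= big1 ?addr0.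
  by rewrite mulf_eq0 (negbTE fa) (negbTE gb).
move=> [k l] /= /andP[/eqP abE kl].
case: (Order.TotalTheory.ltgtP (k : 'X_{1..n}) a) => [/af ->|ak|ka].
- by rewrite mul0r.
- rewrite (bg l) ?mulr0 //; rewrite Order.TotalTheory.ltNge; apply/negP => bl'.
  have := ltmc_le_add ak bl'; by rewrite -abE Order.POrderTheory.ltxx.
case/eqP: kl; congr (_, _); apply: val_inj => //=.
by move: abE; rewrite ka => /addmI.
Qed.

HB.instance Definition _ :=
  GRing.ComUnitRing_isIntegral.Build (mpseries n R) ps_mulf_eq0.

End Domain.

(** * Series in [z] and [t] *)

Lemma mnm_1var (m : 'X_{1..1}) : m = (U_(ord0) *+ m ord0)%MM.
Proof. by apply/mnmP => i; rewrite mulmnE mnm1E !ord1 eqxx mul1n. Qed.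

Lemma mdeg_mulmnU s : mdeg (U_(ord0 : 'I_1) *+ s)%MM = s.
Proof. by rewrite mdegMn mdeg1 mul1n. Qed.

Section OneVariable.
Variable C : comNzRingType.
Implicit Types a b : mpseries 1 C.

(** Multi-indices in one variable are the multiples of [U_(ord0)], which turns the Cauchy product
    into the usual convolution. *)
Lemma ps1var_mulE a b s : (a * b) (U_(ord0) *+ s)%MM =
  \sum_(j < s.+1) a (U_(ord0) *+ j)%MM * b (U_(ord0) *+ (s - j))%MM.
Proof.
set m := (U_(ord0) *+ s)%MM.
pose T (c : mpseries 1 C) := ps_trunc (mdeg m).+1 c.
rewrite psM (@ps_mulE _ _ a b (T a) (T b)) => [|k km|k km];
  try by rewrite ps_truncE.
rewrite (mcoeff_poly_mul_lin _ _ (ltnSn (mdeg m))) /=.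
have UP (j : 'I_s.+1) : (mdeg (U_(ord0 : 'I_1) *+ j)%MM < (mdeg m).+1)%N.
  by rewrite !mdeg_mulmnU.
rewrite (reindex (fun j => BMultinom (UP j))) /=; last first.
  have inP (k : 'X_{1..1 < (mdeg m).+1}) : (k ord0 < s.+1)%N.
    rewrite -(mdeg_mulmnU (k ord0)) -mnm_1var -[X in (_ < X.+1)%N]mdeg_mulmnU.
    exact: bmdeg.
  exists (fun k => Ordinal (inP k)) => [j _|k _]; apply: val_inj => /=.
    by rewrite mulmnE mnm1E eqxx mul1n.
  by rewrite -mnm_1var.
have jm (j : 'I_s.+1) : (U_(ord0 : 'I_1) *+ j <= m)%MM.
  by apply/mnm_lepP => i; rewrite !mulmnE leq_mul2l -ltnS ltn_ord orbT.
apply: eq_big => [j|j _]; first by rewrite jm.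
have -> : (m - U_(ord0) *+ j = U_(ord0) *+ (s - j))%MM.
  by apply/mnmP => i; rewrite mnmBE !mulmnE mulnBr.
by rewrite !ps_truncE // !mdeg_mulmnU // ltnS leq_subr.
Qed.

End OneVariable.

Section Coefficients.
Variables (n : nat) (C : comNzRingType).
Implicit Types (P : mpseries n C) (f g : ztseries n C).

Fact tcoef_is_additive s : zmod_morphism (@tcoef n C s).
Proof. by move=> f g; apply/mpseriesP. Qed.

HB.instance Definition _ s :=
  GRing.isZmodMorphism.Build _ _ (@tcoef n C s) (tcoef_is_additive s).

Fact tderiv_is_additive : zmod_morphism (@tderiv n C).
Proof. by move=> f g; apply/mpseriesP => m; rewrite !psB /= raddfB. Qed.

HB.instance Definition _ :=
  GRing.isZmodMorphism.Build _ _ (@tderiv n C) tderiv_is_additive.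

(** Series are stored as [C[[t]][[z]]], whereas evolution equations are solved degree by degree in
    [t]; this extensionality passes to the point of view of [C[[z]][[t]]]. *)
Lemma tcoefP f g : (forall s, tcoef s f = tcoef s g) -> f = g.
Proof.
move=> fg; apply/mpseriesP => m; apply/mpseriesP => k; rewrite (mnm_1var k).
exact: (congr1 (fun h : mpseries n C => h m) (fg _)).
Qed.

Lemma tcoefM s f g :
  tcoef s (f * g) = \sum_(j < s.+1) tcoef j f * tcoef (s - j) g.
Proof.
apply/mpseriesP => m; rewrite [RHS]ps_sumE /= exchange_big /= ps_sumE.
by apply: eq_bigr => k _; rewrite ps1var_mulE.
Qed.

Lemma tcoef0M : {morph @tcoef n C 0 : f g / f * g}.
Proof. by move=> f g; rewrite tcoefM big_ord1. Qed.

Lemma tcoef1 : tcoef 0 (1 : ztseries n C) = 1.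
Proof.
apply/mpseriesP => m; rewrite /= psMn ps1 /=.
by case: (m == 0%MM); rewrite ?mulr1n ?mulr0n // eqxx.
Qed.

HB.instance Definition _ := GRing.isMonoidMorphism.Build _ _ (@tcoef n C 0)
  (tcoef1, tcoef0M).

Lemma tcoef_scale s (a : mpseries 1 C) f : tcoef s (a *: f) =
  \sum_(j < s.+1) a (U_(ord0) *+ j)%MM *: tcoef (s - j) f.
Proof.
apply/mpseriesP => m; rewrite [RHS]ps_sumE.
by rewrite -[LHS]/((a * f m) (U_(ord0) *+ s)%MM) ps1var_mulE.
Qed.

Lemma tcoef_scaleC s c f : tcoef s (psC c *: f) = c *: tcoef s f.
Proof.
apply/mpseriesP => m; rewrite -[LHS]/((psC c * f m) (U_(ord0) *+ s)%MM).
by rewrite psC_mul.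
Qed.

Lemma tcoef_tvar0 f : tcoef 0 (tvar C *: f) = 0.
Proof.
rewrite tcoef_scale big_ord1 /= (_ : (_ == _) = false) ?scale0r //.
by apply/negP => /eqP/mnmP/(_ ord0); rewrite mulmnE mnm1E muln0.
Qed.

Lemma tcoef_tvarS s f : tcoef s.+1 (tvar C *: f) = tcoef s f.
Proof.
rewrite tcoef_scale (bigD1 (Ordinal (isT : 1 < s.+2)%N)) //= eqxx scale1r.
rewrite subSS subn0 big1 ?addr0 // => j; rewrite -val_eqE /= => j1.
rewrite (_ : (_ == _) = false) ?scale0r //.
apply/negP => /eqP/(congr1 mdeg); rewrite mdeg_mulmnU mdeg1 => j1'.
by rewrite j1' in j1.
Qed.

Lemma tvar_inj f g : tvar C *: f = tvar C *: g -> f = g.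
Proof.
by move=> fg; apply: tcoefP => s; rewrite -tcoef_tvarS fg tcoef_tvarS.
Qed.

Lemma tcoef_zt_const s P :
  tcoef s (zt_const P) = if s is 0%N then P else 0.
Proof.
apply/mpseriesP => m /=; case: s => [|s]; first by rewrite eqxx.
rewrite (_ : (_ == _) = false) //.
by apply/negP => /eqP/(congr1 mdeg); rewrite mdeg_mulmnU mdeg0.
Qed.

Lemma tcoef_tderiv s f : tcoef s (tderiv f) = tcoef s.+1 f *+ s.+1.
Proof.
apply/mpseriesP => m; rewrite psMn /= mulmnE mnm1E eqxx mul1n.
by rewrite mulmSr.
Qed.

Lemma tcoef_deriv s i f : tcoef s (ps_deriv i f) = ps_deriv i (tcoef s f).
Proof. by apply/mpseriesP => m; rewrite /= psMn. Qed.

Lemma tcoef_psX0 i : tcoef 0 (psX i : ztseries n C) = psX i.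
Proof.
by apply/mpseriesP => m /=; case: (m == _) => //; rewrite ps1 eqxx.
Qed.

Lemma ps_order_ge_tcoef d f :
  ps_order_ge d f <-> forall s, ps_order_ge d (tcoef s f).
Proof.
split=> [/ps_order_geP df s|df]; apply/ps_order_geP => m md.
  by rewrite /= df.
apply/mpseriesP => k; rewrite (mnm_1var k) ps0.
by have /ps_order_geP/(_ m md) := df (k ord0).
Qed.

Lemma ps_order_ge_zt_const d P : ps_order_ge d P -> ps_order_ge d (zt_const P).
Proof.
move=> dP; apply/ps_order_ge_tcoef => s; rewrite tcoef_zt_const.
by case: s => // s; exact: ps_order_ge_zero.
Qed.

Lemma ps_deriv_zt_const i P : ps_deriv i (zt_const P) = zt_const (ps_deriv i P).
Proof.
apply: tcoefP => s; rewrite tcoef_deriv !tcoef_zt_const.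
by case: s => // s; rewrite raddf0.
Qed.

Lemma tderivM f g : tderiv (f * g) = tderiv f * g + f * tderiv g.
Proof.
apply/mpseriesP => m; rewrite /= raddf_sum -big_split /=.
by apply: eq_bigr => k _; rewrite ps_derivM.
Qed.

Lemma tderiv_deriv i f : tderiv (ps_deriv i f) = ps_deriv i (tderiv f).
Proof. by apply/mpseriesP => m; rewrite /= raddfMn. Qed.

Lemma tderiv_scaleC c f : tderiv (psC c *: f) = psC c *: tderiv f.
Proof.
apply: tcoefP => s.
by rewrite tcoef_tderiv !tcoef_scaleC tcoef_tderiv scalerMnr.
Qed.

Lemma tderiv_psX i : tderiv (psX i : ztseries n C) = 0.
Proof.
apply/mpseriesP => m; apply/mpseriesP => k /=.
case: (m == _); last by rewrite ps0 mul0rn.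
rewrite ps1 (_ : (_ == _) = false) ?mul0rn //; apply/negP => /eqP/mnmP/(_ ord0).
by rewrite mnmDE mnm1E mnm0E addn1.
Qed.

Lemma tderiv_tvar f : tderiv (tvar C *: f) = f + tvar C *: tderiv f.
Proof.
apply: tcoefP => s; rewrite raddfD /= tcoef_tderiv tcoef_tvarS mulrS.
case: s => [|s]; first by rewrite tcoef_tvar0 mulr0n.
by rewrite tcoef_tvarS tcoef_tderiv.
Qed.

Lemma ps_comp_tvar f (G : 'I_n -> ztseries n C) :
  ps_comp (tvar C *: f) G = tvar C *: ps_comp f G.
Proof. exact: ps_compZ. Qed.

(** Setting [t = 0] is a ring morphism, and it turns [G] into the identity substitution. *)
Lemma tcoef0_comp f (G : 'I_n -> ztseries n C) :
  (forall i, tcoef 0 (G i) = psX i) -> tcoef 0 (ps_comp f G) = tcoef 0 f.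
Proof.
move=> G0; rewrite -[RHS]ps_comp_psX; apply/mpseriesP => m.
rewrite [LHS]/= -/(mmap1 _ _) ps_sumE; apply: eq_bigr => k _.
rewrite ps1var_mulE big_ord1; congr (_ * _).
transitivity (tcoef 0 (mmap1 G k) m) => //.
rewrite /mmap1 rmorph_prod; congr (psfun _ m).
by apply: eq_bigr => i _; rewrite rmorphXn /= G0.
Qed.

Definition zt_of_tcoef (c : nat -> mpseries n C) : ztseries n C :=
  MPSeries (fun m => MPSeries (fun k => c (k ord0) m)).

Lemma zt_of_tcoefK c s : tcoef s (zt_of_tcoef c) = c s.
Proof. by apply/mpseriesP => m; rewrite /= mulmnE mnm1E eqxx mul1n. Qed.

End Coefficients.

(** * Evolution equations *)

Section Transport.
Variables (n : nat) (C : comNzRingType) (u : 'I_n -> ztseries n C).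
Implicit Types (P : mpseries n C) (f g : ztseries n C).

Definition transport f : ztseries n C :=
  tderiv f - \sum_(j < n) u j * ps_deriv j f.

Fact transport_is_additive : zmod_morphism transport.
Proof.
move=> f g; rewrite /transport raddfB.
have -> : \sum_j u j * ps_deriv j (f - g) =
    \sum_j u j * ps_deriv j f - \sum_j u j * ps_deriv j g.
  by rewrite -sumrB; apply: eq_bigr => j _; rewrite -mulrBr raddfB.
by rewrite !opprB addrACA [RHS]addrACA (addrC (- tderiv g)).
Qed.

HB.instance Definition _ :=
  GRing.isZmodMorphism.Build _ _ transport transport_is_additive.

Lemma transportM f g : transport (f * g) = transport f * g + f * transport g.
Proof.
rewrite /transport tderivM mulrBl mulrBr addrACA -opprD; congr (_ - _).
rewrite mulr_suml mulr_sumr -big_split /=; apply: eq_bigr => j _.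
by rewrite ps_derivM mulrDr mulrA [in RHS]mulrCA.
Qed.

Lemma transport_scaleC c f : transport (psC c *: f) = psC c *: transport f.
Proof.
rewrite /transport tderiv_scaleC scalerBr scaler_sumr; congr (_ - _).
by apply: eq_bigr => j _; rewrite linearZ /= scalerAr.
Qed.

Lemma transport1 : transport 1 = 0.
Proof.
by have /eqP := transportM 1 1;
  rewrite !(mulr1, mul1r) -subr_eq subrr => /eqP <-.
Qed.

Hypothesis u1 : forall j, ps_order_ge 1 (u j).

(** Each derivative in [z] lowers the order by at most one, and the factor [u j] restores it. *)
Lemma ps_order_ge_transport d f :
  ps_order_ge d f -> ps_order_ge d (transport f).
Proof.
move=> df; apply: ps_order_geB.
  by apply/ps_order_geP => m md; move/ps_order_geP: df => /(_ m md) /= ->;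
    rewrite raddf0.
apply: ps_order_ge_sum => j _; case: d df => [|d] df; first exact: ps_order_ge0.
apply: (@ps_order_geM _ _ 1 d); [exact: u1 | exact: ps_order_ge_deriv].
Qed.

(** A derivation that kills every [G i] kills each polynomial in them with coefficients constant in
    [t]. Infinite sums follow by approximation, as [transport] preserves the order of the
    remainder. *)
Lemma transport_comp P (G : 'I_n -> ztseries n C) :
    (forall i, ps_order_ge 1 (G i)) -> (forall i, transport (G i) = 0) ->
  transport (ps_comp (zt_const P) G) = 0.
Proof.
move=> G1 DG0; apply: ps_eq0_order => d.
pose S := \sum_(k : 'X_{1..n < d}) psC (P k) *: mmap1 G k.
have DS : transport S = 0.
  rewrite raddf_sum big1 // => k _ /=; rewrite transport_scaleC.
  rewrite (_ : transport _ = 0) ?scaler0 // /mmap1.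
  apply: (big_ind (fun f => transport f = 0)) => [|f g Df Dg|i _].
  - exact: transport1.
  - by rewrite transportM Df Dg mul0r mulr0 addr0.
  elim: (k i) => [|e IH]; first exact: transport1.
  by rewrite exprS transportM DG0 IH mul0r mulr0 addr0.
(* Subtracting the killed partial sum [S] leaves a remainder of order at least [d], for arbitrary
   [d]. *)
rewrite -[X in ps_order_ge d X]subr0 -DS -raddfB; apply: ps_order_ge_transport.
apply/ps_order_geP => m md; rewrite psB.
rewrite (@ps_compE _ _ _ G1 _ (ps_trunc d (zt_const P))) => [|k km]; last first.
  by rewrite ps_truncE // (leq_ltn_trans km).
rewrite raddf_sum /= -psB (_ : _ - _ = 0) //; apply/eqP; rewrite subr_eq0.
by apply/eqP/eq_bigr => k _; rewrite mmapZ mmapX mulr_algl.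
Qed.

End Transport.

Section CharacteristicZero.
Variables (n : nat) (C : numFieldType).
Implicit Types (P : mpseries n C) (f g Q : ztseries n C).

Lemma mulrSn_inj (V : lmodType C) s (x y : V) : x *+ s.+1 = y *+ s.+1 -> x = y.
Proof.
by rewrite -!scaler_nat; apply: scalerI; rewrite Num.Theory.pnatr_eq0.
Qed.

(** In degree [s] of [t], only the time derivative sees the coefficient [s.+1] of [f]; the other
    terms involve coefficients up to [s]. *)
Lemma tcoef_transport_eq0 (u : 'I_n -> ztseries n C) s f :
    (forall j, (j <= s)%N -> tcoef j f = 0) -> tcoef s (transport u f) = 0 ->
  tcoef s.+1 f = 0.
Proof.
move=> f0 /eqP; rewrite /transport raddfB /= subr_eq0 tcoef_tderiv raddf_sum.
rewrite big1 => [/eqP|].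
  by move=> fs; apply: (@mulrSn_inj _ s); rewrite fs mul0rn.
move=> j _ /=; rewrite tcoefM big1 // => i _.
by rewrite tcoef_deriv f0 ?leq_subr // raddf0 mulr0.
Qed.

(** An infinite hierarchy in which each member is driven by the next. Induction on the degree in
    [t], for all members at once, avoids having to close the hierarchy. It is meant for the traces
    of powers of the Hessian. *)
Lemma transport_chain_eq0 (u : 'I_n -> ztseries n C)
    (c : nat -> ztseries n C) (e : nat -> nat) :
    (forall k, transport u (c k) = c k.+1 *+ e k) ->
    (forall k, tcoef 0 (c k) = 0) ->
  forall k, c k = 0.
Proof.
move=> Dc c0 k; apply: tcoefP => s; rewrite raddf0.
elim/ltn_ind: s k => -[|s] IH k; first exact: c0.
apply: (@tcoef_transport_eq0 u) => [j js|]; first exact: IH.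
by rewrite Dc raddfMn /= IH ?mul0rn.
Qed.

Lemma transport_eq0 (u : 'I_n -> ztseries n C) f :
  transport u f = 0 -> tcoef 0 f = 0 -> f = 0.
Proof.
(* A single equation is the chain [f, 0, 0, ...] with all multipliers zero. *)
move=> Df f0; pose c k : ztseries n C := if k is 0%N then f else 0.
by apply: (@transport_chain_eq0 u c (fun=> 0%N) _ _ 0%N) => -[|k] //=;
  rewrite raddf0.
Qed.

(** * Causal equations: uniqueness and Picard iteration *)

Definition causal (Phi : ztseries n C -> ztseries n C) := forall s f g,
  (forall j, (j <= s)%N -> tcoef j f = tcoef j g) ->
  tcoef s (Phi f) = tcoef s (Phi g).

Lemma causal_sum (I : finType) (Phi : I -> ztseries n C -> ztseries n C) :
  (forall i, causal (Phi i)) -> causal (fun f => \sum_i Phi i f).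
Proof.
move=> cPhi s f g fg; rewrite !raddf_sum; apply: eq_bigr => i _.
exact: cPhi.
Qed.

Lemma causalM Phi Psi :
  causal Phi -> causal Psi -> causal (fun f => Phi f * Psi f).
Proof.
move=> cPhi cPsi s f g fg; rewrite !tcoefM; apply: eq_bigr => j _.
congr (_ * _); [apply: cPhi => i ij | apply: cPsi => i ij]; apply: fg.
  by rewrite (leq_trans ij) // -ltnS.
by rewrite (leq_trans ij) // leq_subr.
Qed.

Lemma causal_scaleC c Phi : causal Phi -> causal (fun f => psC c *: Phi f).
Proof. by move=> cPhi s f g fg; rewrite !tcoef_scaleC (cPhi s f g). Qed.

Lemma causal_deriv i Phi : causal Phi -> causal (fun f => ps_deriv i (Phi f)).
Proof. by move=> cPhi s f g fg; rewrite !tcoef_deriv (cPhi s f g). Qed.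

Lemma causal_id : causal id.
Proof. by move=> s f g; apply. Qed.

(** The equation expresses [s.+1] times the coefficient [s.+1] through those up to [s], so the
    initial value determines everything. *)
Lemma causal_solution_unique Phi f g : causal Phi ->
    tderiv f = Phi f -> tderiv g = Phi g -> tcoef 0 f = tcoef 0 g ->
  f = g.
Proof.
move=> cPhi Ef Eg fg0; apply: tcoefP; elim/ltn_ind => -[|s] IH //.
apply: (@mulrSn_inj _ s); rewrite -!tcoef_tderiv Ef Eg.
by apply: cPhi => j js; apply: IH.
Qed.

Section Picard.
Variables (Phi : ztseries n C -> ztseries n C) (P : mpseries n C).
Hypothesis cPhi : causal Phi.

(** Each step integrates [Phi] of the previous iterate from the initial value [P]; the divisor [s]
    is the full index, [s'.+1], as integration in [t] requires. *)
Fixpoint picard k : ztseries n C :=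
  if k is k'.+1 then zt_of_tcoef (fun s =>
    if s is s'.+1 then s%:R^-1 *: tcoef s' (Phi (picard k')) else P)
  else zt_const P.

Definition picard_limit : ztseries n C :=
  zt_of_tcoef (fun s => tcoef s (picard s)).

(** By causality each iteration settles one more coefficient in [t], so the diagonal in
    [picard_limit] is a genuine limit. *)
Lemma picard_stable k j :
  (j <= k)%N -> tcoef j (picard k) = tcoef j picard_limit.
Proof.
rewrite zt_of_tcoefK; elim/ltn_ind: j k => -[|j] IH [|k] // jk.
  by rewrite /= zt_of_tcoefK tcoef_zt_const.
rewrite /= !zt_of_tcoefK; congr (_ *: _); apply: cPhi => i ij.
by rewrite !(IH i) // (leq_trans ij).
Qed.

Lemma picard_limit_tderiv : tderiv picard_limit = Phi picard_limit.
Proof.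
apply: tcoefP => s; rewrite tcoef_tderiv -(picard_stable (leqnn s.+1)) /=.
rewrite zt_of_tcoefK -scaler_nat scalerA divff ?Num.Theory.pnatr_eq0 //.
by rewrite scale1r; apply: cPhi => j; apply: picard_stable.
Qed.

Lemma tcoef0_picard_limit : tcoef 0 picard_limit = P.
Proof. by rewrite zt_of_tcoefK /= tcoef_zt_const. Qed.

Lemma ps_order_ge_picard_limit d :
    (forall f, ps_order_ge d f -> ps_order_ge d (Phi f)) ->
  ps_order_ge d P -> ps_order_ge d picard_limit.
Proof.
move=> dPhi dP; have dk k : ps_order_ge d (picard k).
  elim: k => [|k /dPhi/ps_order_ge_tcoef IH]; first exact: ps_order_ge_zt_const.
  apply/ps_order_ge_tcoef => -[|s]; rewrite zt_of_tcoefK //.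
  exact: ps_order_geZ.
apply/ps_order_ge_tcoef => s; rewrite zt_of_tcoefK.
by have /ps_order_ge_tcoef := dk s.
Qed.

End Picard.

End CharacteristicZero.

(** * Inversion pairs *)

Lemma ps_comp_inverse (n : nat) (R : comNzRingType)
    (F G : 'I_n -> mpseries n R) (f : mpseries n R) :
    (forall i, ps_order_ge 1 (F i)) -> (forall i, ps_order_ge 1 (G i)) ->
    (forall i, ps_comp (F i) G = psX i) ->
  ps_comp (ps_comp f F) G = f.
Proof.
move=> F1 G1 FG; rewrite ps_compA // -[RHS]ps_comp_psX; congr ps_comp.
exact/funext.
Qed.

(** The usual group argument: [G = G o (F o G') = (G o F) o G' = G']. *)
Lemma formal_inverse_unique (n : nat) (R : comNzRingType)
    (F G G' : 'I_n -> mpseries n R) :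
    (forall i, ps_order_ge 1 (F i)) -> (forall i, ps_order_ge 1 (G' i)) ->
    formal_inverse F G -> formal_inverse F G' ->
  forall i, G i = G' i.
Proof.
move=> F1 G'1 [_ GF] [FG' _] i.
by rewrite -(ps_comp_inverse (G i) F1 G'1 FG') GF ps_compX.
Qed.

(* [G] is the identity modulo [t], so [f o G] and [f] have the same lowest
   coefficient in [t]. *)
Lemma ps_comp_eq0 (n : nat) (C : comNzRingType) (G : 'I_n -> ztseries n C)
    (f : ztseries n C) :
    (forall i, tcoef 0 (G i) = psX i) -> ps_comp f G = 0 -> f = 0.
Proof.
move=> G0 fG; apply: tcoefP => s; rewrite raddf0.
elim: s f fG => [|s IH] f fG; first by rewrite -(tcoef0_comp f G0) fG raddf0.
pose g := zt_of_tcoef (fun s => tcoef s.+1 f).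
have fE : f = tvar C *: g.
  apply: tcoefP => -[|j]; last by rewrite tcoef_tvarS zt_of_tcoefK.
  by rewrite tcoef_tvar0 -(tcoef0_comp f G0) fG raddf0.
rewrite fE tcoef_tvarS IH //; apply: tvar_inj.
by rewrite -ps_comp_tvar -fE fG scaler0.
Qed.

(** * The Hamilton-Jacobi equation *)

Section HamiltonJacobi.
Variables (n : nat) (C : numFieldType).
Implicit Types (P : mpseries n C) (Q f : ztseries n C).

(** The order excludes a constant term, and any other monomial is detected by the derivative in a
    variable that it contains, in characteristic zero. *)
Lemma ps_deriv_eq0 (f : ztseries n C) :
  ps_order_ge 1 f -> (forall i, ps_deriv i f = 0) -> f = 0.
Proof.
move=> /ps_order_geP f1 df; apply/mpseriesP => m.
have [/f1 //|] := ltnP (mdeg m) 1.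
rewrite lt0n mdeg_eq0 => m0.
have [i mi] : exists i, m i != 0%N.
  apply: contrapT => mE; case/eqP: m0; apply/mnmP => i; rewrite mnm0E.
  by apply/eqP; apply: contrapT => mi; apply: mE; exists i; apply/negP.
rewrite ps0; have -> : m = (m - U_(i) + U_(i))%MM by rewrite submK // lep1mP.
have := congr1 (fun g : ztseries n C => g (m - U_(i))%MM) (df i).
move=> /= fm0.
by apply: (@mulrSn_inj C _ ((m - U_(i))%MM i)); rewrite fm0 mul0rn.
Qed.

Definition hamilton_jacobi f : ztseries n C :=
  psC 2^-1 *: \sum_(i < n) ps_deriv i f * ps_deriv i f.

Lemma causal_hamilton_jacobi : causal hamilton_jacobi.
Proof.
apply: causal_scaleC; apply: causal_sum => i.
by apply: causalM; apply: causal_deriv; apply: causal_id.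
Qed.

Lemma ps_order_ge_hamilton_jacobi f :
  ps_order_ge 2 f -> ps_order_ge 2 (hamilton_jacobi f).
Proof.
move=> f2; apply: ps_order_geZ; apply: ps_order_ge_sum => i _.
by apply: (@ps_order_geM _ _ 1 1); apply: ps_order_ge_deriv.
Qed.

(** Compares the two evolution equations: their right-hand sides differ by half of
    [f * laplacian f]. *)
Lemma laplacian_sqr f : laplacian (f ^+ 2) =
  (\sum_(i < n) ps_deriv i f * ps_deriv i f + f * laplacian f) *+ 2.
Proof.
rewrite /laplacian mulr_sumr -big_split /= -sumrMnl; apply: eq_bigr => i _.
rewrite expr2 ps_derivM raddfD /= !ps_derivM mulr2n.
by rewrite (mulrC _ f) (addrC (f * _)).
Qed.

Section Solution.
Variables (P : mpseries n C) (Q : ztseries n C).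
Hypothesis P2 : ps_order_ge 2 P.
Hypothesis Q2 : ps_order_ge 2 Q.
Hypothesis Q_HJ : tderiv Q = hamilton_jacobi Q.
Hypothesis Q0 : tcoef 0 Q = P.

Let u i := ps_deriv i Q.
Let F i := psX i - tvar C *: ps_deriv i (zt_const P).
Let G i := psX i + tvar C *: u i.

Let u1 i : ps_order_ge 1 (u i). Proof. exact: ps_order_ge_deriv. Qed.

Let F1 i : ps_order_ge 1 (F i).
Proof.
apply: ps_order_geB; first exact: ps_order_geX.
by apply/ps_order_geZ/ps_order_ge_deriv/ps_order_ge_zt_const.
Qed.

Let G1 i : ps_order_ge 1 (G i).
Proof.
by apply: ps_order_geD; [exact: ps_order_geX | exact: ps_order_geZ].
Qed.

Lemma burgers i : transport u (u i) = 0.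
Proof.
apply/eqP; rewrite /transport subr_eq0; apply/eqP.
rewrite {1}/u tderiv_deriv Q_HJ linearZ /= raddf_sum scaler_sumr.
apply: eq_bigr => j _; rewrite /= ps_derivM -/(u j) mulrC -mulr2n.
(* Because [u] is a gradient, the derivative of [u j] in direction [i] is that of [u i] in direction
   [j]; the factor 2 from the square then cancels the one half. *)
rewrite -[X in ps_deriv i X]/(ps_deriv j Q) ps_derivC -/(u i).
apply: tcoefP => s; rewrite tcoef_scaleC raddfMn /= -scaler_nat scalerA.
by rewrite mulVf ?scale1r // Num.Theory.pnatr_eq0.
Qed.

(** The transport of [z_i] is [- u i], and that of [t u_i] is [u i] plus [t] times the vanishing
    transport of [u i]. *)
Let DG i : transport u (G i) = 0.
Proof.
rewrite raddfD /= /transport tderiv_psX tderiv_tvar sub0r.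
rewrite (bigD1 i) //= ps_derivX eqxx mulr1 big1 ?addr0; last first.
  by move=> j /negbTE ji; rewrite ps_derivX ji mulr0.
rewrite -addrA addKr; have /eqP := burgers i.
rewrite /transport subr_eq0 => /eqP ->; apply/eqP; rewrite subr_eq0; apply/eqP.
by rewrite scaler_sumr; apply: eq_bigr => j _; rewrite linearZ /= scalerAr.
Qed.

Let G0 i : tcoef 0 (G i) = psX i.
Proof. by rewrite raddfD /= tcoef_psX0 tcoef_tvar0 addr0. Qed.

(* Both sides are constant along the flow of the transport operator and agree
   at [t = 0]. *)
Let uE i : ps_comp (ps_deriv i (zt_const P)) G = u i.
Proof.
apply/eqP; rewrite -subr_eq0; apply/eqP; apply: (@transport_eq0 _ _ u).
  by rewrite raddfB /= burgers ps_deriv_zt_const transport_comp // subr0.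
rewrite raddfB /= tcoef0_comp // !tcoef_deriv tcoef_zt_const Q0.
by rewrite subrr.
Qed.

Let FG i : ps_comp (F i) G = psX i.
Proof.
by rewrite ps_compB ps_compZ ps_compX // uE addrK.
Qed.

Lemma hamilton_jacobi_inversion_pair : inversion_pair P Q.
Proof.
split; first exact: Q2.
split=> i; first exact: FG.
(* Substituting [G] into [G o F - z] gives [G o (F o G) - G = 0], and this substitution is
   injective. *)
apply/eqP; rewrite -subr_eq0; apply/eqP; apply: (ps_comp_eq0 G0).
rewrite ps_compB ps_compX //.
by apply/eqP; rewrite subr_eq0; apply/eqP; exact: ps_comp_inverse F1 G1 FG.
Qed.

Let H := hessian Q.

(** Apply [ps_deriv i] to the Burgers equation for [u k]: the derivative falling on the coefficients
    [u j] produces the matrix product. *)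
Lemma transport_hessian : map_mx (transport u) H = H *m H.
Proof.
apply/matrixP => i k; rewrite !mxE.
have := congr1 (ps_deriv i) (burgers k).
rewrite raddf0 /transport raddfB /= raddf_sum -tderiv_deriv => /eqP.
rewrite subr_eq0 => /eqP ->; rewrite -sumrB; apply: eq_bigr => j _.
by rewrite /= ps_derivM !mxE (ps_derivC i j) addrK.
Qed.

Lemma map_transportM (A B : 'M[ztseries n C]_n) :
  map_mx (transport u) (A *m B) =
    map_mx (transport u) A *m B + A *m map_mx (transport u) B.
Proof.
apply/matrixP => i k; rewrite !mxE raddf_sum -big_split /=.
by apply: eq_bigr => j _; rewrite transportM !mxE.
Qed.

(** The scalar power rule survives for matrices, since the transport of [H] is [H *m H], which
    commutes with [H]. *)
Lemma transport_hessianX k :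
  map_mx (transport u) (H ^+ k) = H ^+ k.+1 *+ k.
Proof.
elim: k => [|k IH].
  by apply/matrixP => i j; rewrite mulr0n !mxE raddfMn /= transport1 mul0rn.
rewrite exprSr -mulmxE map_transportM IH transport_hessian mulmxE.
by rewrite mulrnAl -!exprSr mulrA -!exprSr -mulrSr.
Qed.

Lemma laplacian_eq0 : hessian_nilpotent P -> laplacian Q = 0.
Proof.
case=> N PN; have <- : \tr (H ^+ 1) = laplacian Q.
  by rewrite expr1; apply: eq_bigr => i _; rewrite mxE.
(* The chain starts at exponent 1: its member 0 is the Laplacian, and the power 0, whose trace need
   not vanish, is left out. *)
apply: (@transport_chain_eq0 _ _ u (fun k => \tr (H ^+ k.+1)) succn _ _ 0%N).
  move=> k; rewrite -raddfMn -transport_hessianX raddf_sum.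
  by apply: eq_bigr => i _; rewrite mxE.
move=> k; have <- : \tr (hessian P ^+ k.+1) = tcoef 0 (\tr (H ^+ k.+1)).
  have HP : map_mx (tcoef 0) H = hessian P.
    by apply/matrixP => i j; rewrite !mxE !tcoef_deriv Q0.
  rewrite -trace_map_mx; congr (\tr _); elim: k.+1 => [|e IH].
    by rewrite !expr0 map_mx1.
  by rewrite !exprS IH -!mulmxE map_mxM HP.
by apply: (@mxtrace_nilpotent _ _ _ N); rewrite -exprM mulnC exprM PN expr0n.
Qed.

Lemma hamilton_jacobi_cauchy : hessian_nilpotent P -> cauchy_solution P Q.
Proof.
move=> /laplacian_eq0 LQ; split; last exact: Q0.
rewrite Q_HJ laplacian_sqr LQ mulr0 addr0.
apply: tcoefP => s; rewrite !tcoef_scaleC raddfMn /= -scaler_nat scalerA.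
congr (_ *: _); rewrite (natrM _ 2 2) invfM -mulrA mulVf ?mulr1 //.
by rewrite Num.Theory.pnatr_eq0.
Qed.

End Solution.

(** * Uniqueness, existence and the recurrence *)

Lemma cauchy_solution_unique P Q Q' :
  cauchy_solution P Q -> cauchy_solution P Q' -> Q = Q'.
Proof.
move=> [EQ Q0] [EQ' Q'0].
pose Phi f : ztseries n C := psC 4^-1 *: laplacian (f ^+ 2).
apply: (@causal_solution_unique _ _ Phi _ _ _ EQ EQ'); last by rewrite Q0 Q'0.
apply: causal_scaleC; apply: causal_sum => i; do 2!apply: causal_deriv.
by move=> s f g fg; rewrite !expr2; apply: causalM fg; apply: causal_id.
Qed.

(** Uniqueness of formal inverses determines [t] times the gradient; [t] can be cancelled, and the
    order condition fixes the constant of integration. *)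
Lemma inversion_pair_unique P Q Q' : ps_order_ge 2 P ->
  inversion_pair P Q -> inversion_pair P Q' -> Q = Q'.
Proof.
move=> P2 [Q2 Qinv] [Q'2 Q'inv]; apply/eqP; rewrite -subr_eq0; apply/eqP.
apply: ps_deriv_eq0; first by apply: ps_order_ge_leq (ps_order_geB Q2 Q'2).
move=> i; apply/eqP; rewrite raddfB /= subr_eq0; apply/eqP/tvar_inj.
apply: (addrI (psX i)).
apply: (formal_inverse_unique _ _ Qinv Q'inv) => j.
  apply: ps_order_geB; first exact: ps_order_geX.
  by apply/ps_order_geZ/ps_order_ge_deriv/ps_order_ge_zt_const.
apply: ps_order_geD; first exact: ps_order_geX.
by apply/ps_order_geZ/ps_order_ge_deriv.
Qed.

Lemma exists_common_solution P : hessian_nilpotent P -> ps_order_ge 2 P ->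
  exists2 Q, inversion_pair P Q & cauchy_solution P Q.
Proof.
move=> hP P2; pose Q := picard_limit hamilton_jacobi P.
have Q_HJ := picard_limit_tderiv P causal_hamilton_jacobi.
have Q0 := tcoef0_picard_limit hamilton_jacobi P.
have Q2 : ps_order_ge 2 Q.
  exact: ps_order_ge_picard_limit ps_order_ge_hamilton_jacobi P2.
by exists Q;
  [exact: hamilton_jacobi_inversion_pair | exact: hamilton_jacobi_cauchy].
Qed.

(** This is the coefficient of [t^s] in the Cauchy equation. *)
Lemma cauchy_solution_recurrence P Q s : cauchy_solution P Q ->
  tcoef s.+1 Q = (4%:R * s.+1%:R)^-1 *:
    laplacian (\sum_(j < s.+1) tcoef j Q * tcoef (s - j) Q).
Proof.
case=> EQ _; apply: (@mulrSn_inj _ _ s); rewrite -tcoef_tderiv EQ tcoef_scaleC.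
rewrite -scaler_nat scalerA invfM mulrCA divff ?Num.Theory.pnatr_eq0 // mulr1.
congr (_ *: _); rewrite -tcoefM -expr2 raddf_sum; apply: eq_bigr => i _.
by rewrite /= !tcoef_deriv.
Qed.

End HamiltonJacobi.

Theorem theorem3p1 (R : realType) (n : nat)
    (P : mpseries n R[i]) (hP : hessian_nilpotent P) (hPo : ps_order_ge 2 P) :
  (forall Q : ztseries n R[i], ps_order_ge 2 Q ->
     (deformed_inversion_pair P Q <-> unique (cauchy_solution P) Q)) /\
  (forall Q : ztseries n R[i], deformed_inversion_pair P Q ->
     let Qm (m : nat) : mpseries n R[i] := tcoef m.-1 Q in
     Qm 1%N = P /\
     forall m : nat, (2 <= m)%N ->
       Qm m = (4%:R * (m - 1)%N%:R)^-1 *: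
         laplacian (\sum_(1 <= k < m) \sum_(1 <= l < m | (k + l == m)%N)
                       Qm k * Qm l)).
Proof.
(* A common solution [Q0], together with uniqueness on both sides, identifies the two problems. *)
have [Q0 Q0inv Q0sol] := exists_common_solution hP hPo.
split=> [Q _|Q [Qinv _] Qm].
  split=> [[Qinv _]|[Qsol _]].
    rewrite (inversion_pair_unique hPo Qinv Q0inv); split=> // Q'.
    exact: cauchy_solution_unique.
  rewrite (cauchy_solution_unique Qsol Q0sol); split=> // Q'.
  exact: inversion_pair_unique.
have Qsol : cauchy_solution P Q.
  by rewrite (inversion_pair_unique hPo Qinv Q0inv).
split=> [|[|[|s]] // _]; first by case: Qsol.
rewrite /Qm subn1 /= (cauchy_solution_recurrence s Qsol).
congr (_ *: laplacian _).
(* Here [m = s.+2] and [k = j.+1]; the condition [k + l = m] leaves the single shifted index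
   [rev_ord j], whose value is [s - j]. *)
rewrite big_add1 big_mkord; apply: eq_bigr => j _.
rewrite big_add1 big_mkord (big_pred1 (rev_ord j)) //= => k.
rewrite -[RHS]/(k == rev_ord j) -val_eqE /= addSn addnS !eqSS subSS.
by rewrite -[RHS](eqn_add2l j) subnKC // -ltnS.
Qed.
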